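(* For all integers $n,k,h$ with $2\le k\le n-1$ and $0\le h\le n-k$, $\kappa_s^{(h)}(S_{n,k})=n+h(k-2)-1$.
   Context: For integers $1\le k\le n-1$, let $I_n=\{1,\dots,n\}$ and $P(n,k)$ the set of $k$-permutations $p_1p_2\cdots p_k$ of distinct elements of $I_n$. The $(n,k)$-star graph $S_{n,k}$ has vertex set $P(n,k)$; a vertex $p=p_1p_2\cdots p_k$ is adjacent to (a) each vertex obtained by swapping $p_1$ with $p_i$ for $2\le i\le k$, and (b) each vertex $\alpha p_2\cdots p_k$ with $\alpha\in I_n\setminus\{p_1,\dots,p_k\}$. For a connected graph $G$ and integer $h\ge 0$, a set $S\subseteq V(G)$ is an $h$-cut ($h$-super vertex-cut) if $G-S$ is disconnected and has minimum degree at least $h$; the $h$-super connectivity $\kappa_s^{(h)}(G)$ is the minimum cardinality of an $h$-cut of $G$. *)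

(* Defs.v *)
From mathcomp Require Import all_boot.
Set Implicit Arguments. Unset Strict Implicit. Unset Printing Implicit Defensive.

(* The symbol set I_n = {1,...,n} is represented by 'I_n = {0,...,n-1}
   (a relabelling).  Positions 1..k of a k-permutation are 0..k-1. *)

Definition kperm (n k : nat) := {t : k.-tuple 'I_n | uniq t}.

Definition swap0 (i j : nat) : nat :=
  if j == 0 then i else if j == i then 0 else j.

(* Adjacency of S_{n,k}:
   (a) q is p with p_1 and p_i swapped, 2 <= i <= k (positions 0 and i, 1<=i<=k-1);
   (b) q = alpha p_2 ... p_k with alpha not among p_1..p_k. *)
Definition star_adj (n k : nat) (p q : kperm n k) : bool :=
  let P := map val (val p) in
  let Q := map val (val q) in
  [|| [exists i : 'I_k, (0 < val i) &&
          [forall j : 'I_k, nth 0 Q j == nth 0 P (swap0 i j)]]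
    | (0 < k) && (nth 0 Q 0 \notin P) && (behead Q == behead P)].

Section Cuts.
Variables (T : finType) (e : rel T).

Definition del_rel (S : {set T}) : rel T :=
  fun x y => [&& x \notin S, y \notin S & e x y].

Definition disconnected_minus (S : {set T}) : Prop :=
  exists x y, [/\ x \notin S, y \notin S & ~~ connect (del_rel S) x y].

Definition mindeg_minus_ge (S : {set T}) (h : nat) : Prop :=
  forall x, x \notin S -> h <= #|[set y | del_rel S x y]|.

Definition h_cut (h : nat) (S : {set T}) : Prop :=
  disconnected_minus S /\ mindeg_minus_ge S h.

Definition h_super_conn_eq (h m : nat) : Prop :=
  (exists S : {set T}, h_cut h S /\ #|S| = m) /\
  (forall S : {set T}, h_cut h S -> m <= #|S|).
End Cuts.

(* Main.v *)
(* Upper bound: delete the neighbourhood of h + 1 vertices of one of the cliques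
   K_(n-k+1) formed by the vertices with the same symbols p_2 ... p_k.

   Lower bound: split V - S into nonempty parts X and Y without edges between
   them, and split the graph into n copies of S_(n-1,k-1) according to the last
   symbol.  Each vertex has exactly one neighbour outside its copy, and any two
   copies are joined by a matching.
   - If two copies meet both X and Y, induct in each of them with h - 1.
   - Otherwise, if some copy misses Y and some other copy meets Y but not X, S
     contains an endpoint of each matching edge between two such copies.
   - Otherwise X or Y, say X, lies in a single copy H.  Then S contains N_H(X) and
     the neighbours of X outside H, so that |S| >= |N_H[X]|, the closed
     neighbourhood; this is bounded by a separate induction that requires only
     the minimum degree of X. *)

Require Import Defs.
From mathcomp Require Import all_boot.
From mathcomp Require Import zify.

Set Implicit Arguments. Unset Strict Implicit. Unset Printing Implicit Defensive.

(** * Arithmetic of the inductive bounds, with [d] standing for [n - k] *)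

(** Serves the case of two subblocks that both meet both sides: the second copy of [d], with
    [h <= d], makes up for the degree lost in each. *)
Lemma split_bound d m h a b c :
    0 < d -> h <= d -> m != 0 -> a + b <= c ->
    d + m.+1 - 1 + h.-1 * (m.+1 - 2) <= a ->
    d + m.+1 - 1 + h.-1 * (m.+1 - 2) <= b ->
  d + m.+2 - 1 + h * (m.+2 - 2) <= c.
Proof.
move=> d_gt0 le_hd m_n0 le_c le_a le_b.
apply: leq_trans le_c; apply: leq_trans (leq_add le_a le_b).
case: m m_n0 {le_a le_b} => // m _; case: h le_hd => [|h] le_hd; first lia.
have -> : m.+2 - 2 = m by lia.
have -> : m.+3 - 2 = m.+1 by lia.
by rewrite /= mulnS mulSn; nia.
Qed.

(** Here [a] and [b] will count the subblocks at the two ends of the matching edges, [c] those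
    meeting both sides; the last factor is the number of edges counted for each pair. *)
Lemma cross_bound d m h a b c :
    0 < d -> h <= d -> m != 0 -> 0 < a -> 0 < b -> c <= 1 ->
    a + b + c = d + m.+2 ->
  d + m.+2 - 1 + h * (m.+2 - 2) <= a * b * (d + m.+1 - 1).
Proof.
move=> d_gt0 le_hd m_n0 a_gt0 b_gt0 le_c1 sum_abc.
(* Positive [a] and [b] satisfy [a * b >= a + b - 1], and here [a + b >= d + m + 1]. *)
have le_ab : d + m <= a * b by nia.
have -> : m.+2 - 2 = m by lia.
have -> : d + m.+1 - 1 = d + m by lia.
apply: leq_trans (leq_mul le_ab (leqnn _)).
by have := leq_mul le_hd (leqnn m); nia.
Qed.

Lemma pair_bound d m h : 0 < d -> h <= d ->
  d + m.+2 + h * (m.+2 - 1) <= d + m.+1 + h.-1 * m + (d + m.+1 + h.-1 * m).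
Proof.
rewrite subn1 /=; case: h => [|h] d_gt0 le_hd /=; first lia.
by rewrite mulnS mulSn; lia.
Qed.

(** * Symbols of a k-permutation, swaps and relabellings *)

Section StarGraph.
Variables n k : nat.
Implicit Types (p q w x y : kperm n k) (X Y : {set kperm n k}).

Definition sym p (j : nat) : nat := nth 0 (map val (val p)) j.

Lemma size_syms p : size (map val (val p)) = k.
Proof. by rewrite size_map size_tuple. Qed.

Lemma sym_tnth p (j : 'I_k) : sym p j = tnth (val p) j.
Proof.
by rewrite /sym (nth_map (tnth (val p) j)) ?size_tuple // -tnth_nth.
Qed.

Lemma sym_lt p j : j < k -> sym p j < n.
Proof. by move=> lt_jk; rewrite (sym_tnth p (Ordinal lt_jk)). Qed.

Lemma sym_inj p i j : i < k -> j < k -> sym p i = sym p j -> i = j.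
Proof.
move=> lt_ik lt_jk /eqP; rewrite nth_uniq ?size_syms ?(map_inj_uniq val_inj) //.
  by move/eqP.
exact: valP p.
Qed.

Lemma kperm_ext p q : (forall j, j < k -> sym p j = sym q j) -> p = q.
Proof.
move=> eq_pq; apply/val_inj/eq_from_tnth => j; apply: val_inj.
by rewrite /= -!sym_tnth eq_pq.
Qed.

Lemma kperm_exists (f : nat -> nat) :
    (forall j, j < k -> f j < n) ->
    (forall i j, i < k -> j < k -> f i = f j -> i = j) ->
  exists p, forall j, j < k -> sym p j = f j.
Proof.
move=> f_lt f_inj.
pose g (j : 'I_k) : 'I_n := Ordinal (f_lt j (ltn_ord j)).
have g_uniq : uniq [tuple g j | j < k].
  rewrite /= map_inj_uniq ?enum_uniq // => i j /(congr1 val) /= eq_f.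
  by apply/val_inj/(f_inj _ _ (ltn_ord i) (ltn_ord j) eq_f).
exists (Sub [tuple g j | j < k] g_uniq : kperm n k) => j lt_jk.
by rewrite (sym_tnth _ (Ordinal lt_jk)) SubK tnth_mktuple.
Qed.

(** Selecting the vertex by its symbols keeps [swap] total in [i]; for [i < k] such a vertex exists
    and the default [p] is never reached. *)
Definition swap i p : kperm n k :=
  odflt p [pick q | [forall j : 'I_k, sym q j == sym p (swap0 i j)]].

Lemma sym_swap i p j : i < k -> j < k -> sym (swap i p) j = sym p (swap0 i j).
Proof.
move=> lt_ik lt_jk; rewrite /swap; case: pickP => [q /forallP Hq | no].
  exact/eqP/(Hq (Ordinal lt_jk)).
have [||q Hq] := @kperm_exists (fun j => sym p (swap0 i j)).
- by move=> a lt_ak; apply: sym_lt; rewrite /swap0; do 2?case: ifP; lia.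
- move=> a b lt_ak lt_bk /sym_inj; rewrite /swap0.
  by do ?case: ifP; lia.
by have /forallP[] := negbT (no q) => a; apply/eqP/Hq.
Qed.

Lemma sym_swap0 i p : i < k -> sym (swap i p) 0 = sym p i.
Proof. by move=> lt_ik; rewrite sym_swap //; lia. Qed.

Lemma sym_swapi i p : i < k -> sym (swap i p) i = sym p 0.
Proof.
move=> lt_ik; rewrite sym_swap // /swap0 eqxx.
by case: eqP => // ->.
Qed.

Lemma sym_swap_neq i p j :
  i < k -> 0 < j < k -> j != i -> sym (swap i p) j = sym p j.
Proof.
move=> lt_ik /andP[j_gt0 lt_jk] neq_ji; rewrite sym_swap // /swap0.
by rewrite (negbTE neq_ji) -[j == 0]negbK -lt0n j_gt0.
Qed.

Lemma swapK i : i < k -> involutive (swap i).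
Proof.
move=> lt_ik p; apply: kperm_ext => j lt_jk.
have [-> | j_gt0] := posnP j; first by rewrite sym_swap0 ?sym_swapi.
have [-> | neq_ji] := eqVneq j i; first by rewrite sym_swapi ?sym_swap0.
by rewrite !sym_swap_neq ?j_gt0.
Qed.

Lemma relabel p a c : a < k -> c < n ->
  exists2 q, sym q a = c &
    forall j, j < k -> j != a -> sym p j != c -> sym q j = sym p j.
Proof.
move=> lt_ak lt_cn.
(* If [c] already occurs in [p], its position receives the symbol displaced from [a], which keeps
   [f] injective. *)
pose f j := if j == a then c else if sym p j == c then sym p a else sym p j.
have [||q Hq] := @kperm_exists f.
- by move=> j lt_jk; rewrite /f; do 2?case: ifP => _ //; apply: sym_lt.
- move=> i j lt_ik lt_jk; rewrite /f.
  have := @sym_inj p i j lt_ik lt_jk; have := @sym_inj p i a lt_ik lt_ak.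
  have := @sym_inj p j a lt_jk lt_ak.
  by do 4?case: eqP => //; lia.
exists q => [|j lt_jk /negbTE neq_ja /negbTE neq_jc]; rewrite Hq // /f ?eqxx //.
by rewrite neq_ja neq_jc.
Qed.

(** * Blocks and adjacency *)

(* The vertices agreeing with [w] from position [m] on induce a copy of
   S_{n-k+m,m}; this replaces the usual recursive decomposition, without any
   relabelling of symbols. *)
Definition block m w : {set kperm n k} :=
  [set p | [forall j : 'I_k, (m <= j) ==> (sym p j == sym w j)]].

Lemma blockP m w p :
  reflect (forall j, m <= j < k -> sym p j = sym w j) (p \in block m w).
Proof.
rewrite inE; apply: (iffP forallP) => [H j /andP[le_mj lt_jk] | H j].
  by apply/eqP; apply: (implyP (H (Ordinal lt_jk))).
by apply/implyP => le_mj; apply/eqP/H; rewrite le_mj /=.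
Qed.

Lemma block_refl m w : w \in block m w.
Proof. exact/blockP. Qed.

Lemma block_eq m w x : x \in block m w -> block m x = block m w.
Proof.
move/blockP=> Hx; apply/setP=> p.
by apply/blockP/blockP=> Hp j Hj; rewrite Hp ?Hx.
Qed.

Lemma block_sub m1 m2 w : m1 <= m2 -> block m1 w \subset block m2 w.
Proof.
by move=> le_m; apply/subsetP=> p /blockP Hp; apply/blockP=> j Hj; apply: Hp; lia.
Qed.

Lemma blockS m w p :
  p \in block m.+1 w -> sym p m = sym w m -> p \in block m w.
Proof.
move=> /blockP Hp eq_m; apply/blockP=> j Hj.
by have [-> // | neq_jm] := eqVneq j m; apply: Hp; lia.
Qed.

Lemma blockS_neq m w p :
  m < k -> p \in block m.+1 w -> p \notin block m w -> sym p m != sym w m.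
Proof. by move=> lt_mk Hp; apply: contra => /eqP/(blockS Hp). Qed.

Lemma block_disjoint m x y :
  m < k -> sym x m != sym y m -> [disjoint block m x & block m y].
Proof.
move=> lt_mk; apply: contraR => /pred0Pn[p /= /andP[/blockP Hx /blockP Hy]].
by rewrite -Hx ?Hy ?leqnn.
Qed.

Lemma block_full w p : p \in block k w.
Proof. by apply/blockP=> j; lia. Qed.

Lemma swap_block m w p : m < k -> p \in block m.+1 w -> swap m p \in block m.+1 w.
Proof.
move=> lt_mk /blockP Hp; apply/blockP=> j Hj.
by rewrite sym_swap_neq ?Hp; lia.
Qed.

Lemma adjP p q : 0 < k ->
  reflect ((exists2 i, 0 < i < k & q = swap i p) \/ (q != p /\ q \in block 1 p))
    (star_adj p q).
Proof.
move=> k_gt0; apply: (iffP orP) => -[].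
- case/existsP=> i /andP[i_gt0 /forallP Hi]; left; exists i.
    by rewrite i_gt0 /=.
  apply: kperm_ext => j lt_jk; rewrite sym_swap //.
  exact/eqP/(Hi (Ordinal lt_jk)).
- case/andP=> /andP[_ q0_notin] /eqP eq_tl; right; split.
    apply: contraNneq q0_notin => ->; apply: mem_nth; by rewrite size_syms.
  apply/blockP=> -[|j] // Hj.
  by rewrite /sym -[in LHS]nth_behead eq_tl nth_behead.
- case=> i /andP[i_gt0 lt_ik] ->; left; apply/existsP; exists (Ordinal lt_ik).
  rewrite i_gt0; apply/forallP=> j; apply/eqP.
  exact: (@sym_swap (Ordinal lt_ik)).
- case=> neq_qp /blockP Hq; right; rewrite k_gt0 /=; apply/andP; split.
    apply/negP => /(nthP 0)[j]; rewrite size_syms => lt_jk.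
    rewrite -/(sym p j) -/(sym q 0) => eq_j.
    have [j0 | j_gt0] := posnP j.
      case/eqP: neq_qp; apply: kperm_ext => -[|i] lt_ik; last exact: Hq.
      by rewrite -eq_j j0.
    have := @sym_inj q j 0 lt_jk k_gt0; rewrite Hq ?j_gt0 //.
    by move/(_ eq_j); lia.
  apply/eqP/(@eq_from_nth _ 0); rewrite !size_behead !size_syms // => j lt_j.
  by rewrite !nth_behead; apply: Hq; lia.
Qed.

Lemma adj_swap i p : 0 < i < k -> star_adj p (swap i p).
Proof. by move=> Hi; apply/adjP; [lia | left; exists i]. Qed.

Lemma adj_block1 p q : 0 < k -> q != p -> q \in block 1 p -> star_adj p q.
Proof. by move=> k_gt0 neq Hq; apply/adjP => //; right. Qed.

Lemma adj_sym p q : 0 < k -> star_adj p q -> star_adj q p.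
Proof.
move=> k_gt0 /(adjP _ _ k_gt0)[[i Hi ->] | [neq Hq]].
  by rewrite -{2}(@swapK i _ p) ?adj_swap //; lia.
by rewrite adj_block1 1?eq_sym // (block_eq Hq) block_refl.
Qed.

(** A swap at a position above [m] would alter a symbol fixed in [block m.+1 w], and every other
    edge except [swap m] preserves the symbol at [m]. Hence each vertex has a single neighbour
    outside its subblock. *)
Lemma adj_blockS m w p q : 0 < m < k ->
    p \in block m.+1 w -> q \in block m.+1 w -> star_adj p q ->
  q \in block m p \/ q = swap m p.
Proof.
move=> /andP[m_gt0 lt_mk] /blockP Hp /blockP Hq.
case/adjP; first lia.
  case=> i /andP[i_gt0 lt_ik] def_q.
  have [lt_mi | lt_im | ->] := ltngtP m i; last by right.
  - have := Hq i; rewrite lt_mi lt_ik -Hp ?lt_mi // => /(_ isT).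
    by rewrite def_q sym_swapi // => /sym_inj; lia.
  - left; apply/blockP=> j Hj; rewrite def_q sym_swap_neq //; lia.
case=> _ Hq1; left; exact: (subsetP (block_sub p m_gt0)).
Qed.

(** * Available symbols and the cliques [block 1 w] *)

(** The symbols that remain free inside [block m w]; those of [avail m.+1 w] label the subblocks of
    [block m.+1 w] by their symbol at position [m]. *)
Definition avail m w : {set 'I_n} := [set i : 'I_n | i \notin drop m (val (val w))].

Lemma card_avail m w : #|avail m w| = n - (k - m).
Proof.
have <- : #|[set i in drop m (val (val w))]| = k - m.
  rewrite cardsE (card_uniqP _) ?size_drop ?size_tuple //.
  exact/drop_uniq/(valP w).
have := cardsC [set i in drop m (val (val w))]; rewrite card_ord => def_n.
rewrite -[X in X - _]def_n addKn; apply: eq_card => i; by rewrite !inE.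
Qed.

Lemma availP m w (i : 'I_n) :
  reflect (forall j, m <= j < k -> sym w j != i) (i \in avail m w).
Proof.
rewrite inE; apply: (iffP idP) => [Hi j /andP[le_mj lt_jk] | Hi].
  apply: contra Hi => /eqP eq_i.
  have -> : i = nth i (drop m (val (val w))) (j - m).
    apply: val_inj; rewrite nth_drop subnKC //= -eq_i.
    by rewrite /sym (nth_map i) ?size_tuple.
  by apply: mem_nth; rewrite size_drop size_tuple; lia.
apply/negP => /(nthP i)[j]; rewrite size_drop size_tuple => lt_j.
rewrite nth_drop => eq_i; have := Hi (m + j).
rewrite /sym (nth_map i) ?size_tuple; last lia.
by rewrite eq_i eqxx; lia.
Qed.

Lemma avail_sym m w p j (i : 'I_n) :
  p \in block m w -> j < m -> j < k -> sym p j = i -> i \in avail m w.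
Proof.
move=> /blockP Hp lt_jm lt_jk eq_i; apply/availP => a Ha.
rewrite -eq_i -Hp //; apply/eqP => /sym_inj; lia.
Qed.

Lemma relabel_block m w p a (c : 'I_n) :
    a < m <= k -> p \in block m w -> c \in avail m w ->
  exists q, [/\ q \in block m w, sym q a = c &
    forall j, j < k -> j != a -> sym p j != c -> sym q j = sym p j].
Proof.
move=> /andP[lt_am le_mk] /blockP Hp /availP Hc.
have [||q q_a Hq] := @relabel p a c; [lia | by [] |].
exists q; split=> //; apply/blockP=> j Hj.
by rewrite Hq ?Hp //; [lia | lia | exact: Hc].
Qed.

(** Symbols as ordinals, so that labels form finite sets; the default [i0] is not reached for
    [j < k]. *)
Definition osym (i0 : 'I_n) p j : 'I_n := insubd i0 (sym p j).

Lemma val_osym i0 p j : j < k -> val (osym i0 p j) = sym p j.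
Proof. by move=> lt_jk; rewrite val_insubd sym_lt. Qed.

Hypothesis lt_kn : k < n.

(** The first symbol determines a vertex of the block and ranges over [avail 1 w]. *)
Lemma card_block1 w : 0 < k -> #|block 1 w| = n - k + 1.
Proof.
move=> k_gt0; transitivity #|avail 1 w|; last by rewrite card_avail; lia.
pose i0 : 'I_n := Ordinal (sym_lt w k_gt0).
have inj0 : {in block 1 w &, injective (fun p => osym i0 p 0)}.
  move=> p q /blockP Hp /blockP Hq /(congr1 val); rewrite !val_osym // => eq0.
  by apply: kperm_ext => -[|j] Hj //; rewrite Hp ?Hq.
rewrite -(card_in_imset inj0); apply: eq_card => i; apply/imsetP/idP.
  by case=> p Hp ->; apply: (avail_sym Hp (j := 0)); rewrite // val_osym.
move=> Hi; have [|q [Hq q0 _]] := @relabel_block 1 w w 0 i _ (block_refl _ _) Hi.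
  by rewrite k_gt0.
by exists q => //; apply: val_inj; rewrite val_osym.
Qed.

(** * Closed neighbourhoods of sets of given minimum degree *)

Definition mindeg X h : Prop :=
  forall x, x \in X -> h <= #|[set y in X | star_adj x y]|.

Definition closed_nbhd m w X : {set kperm n k} :=
  [set y in block m w | (y \in X) || [exists x in X, star_adj x y]].

Lemma mindeg_card X h x : 0 < k -> x \in X -> mindeg X h -> h < #|X|.
Proof.
move=> k_gt0 Xx /(_ x Xx) le_h; apply: leq_ltn_trans le_h _.
rewrite (cardsD1 x X) Xx ltnS; apply/subset_leq_card/subsetP => y.
rewrite !inE => /andP[-> adj_xy]; rewrite andbT.
apply: contraTneq adj_xy => ->; apply/negP => /(adjP _ _ k_gt0)[].
  case=> i /andP[i_gt0 lt_ik] /(congr1 (fun p => sym p i)).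
  by rewrite sym_swapi // => /sym_inj; lia.
by rewrite eqxx; case.
Qed.

(** The only neighbour of [v] that restriction to its subblock can lose is [swap m v]. *)
Lemma mindeg_block m w X h x : 0 < m < k -> X \subset block m.+1 w ->
  mindeg X h -> mindeg (X :&: block m x) h.-1.
Proof.
move=> Hm /subsetP sXw degX v /setIP[Xv Hv].
have := degX v Xv; set A := [set y in X | _]; set B := [set y in _ | _] => le_h.
have sAB : A \subset swap m v |: B.
  apply/subsetP=> y; rewrite !inE => /andP[Xy adj_vy].
  case: (adj_blockS Hm (sXw _ Xv) (sXw _ Xy) adj_vy) => [Hy | ->]; last by rewrite eqxx.
  by move: Hy; rewrite (block_eq Hv) inE adj_vy Xy /= => ->; rewrite orbT.
by have := subset_leq_card sAB; rewrite cardsU1; lia.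
Qed.

Lemma closed_nbhd_block m w X x : x \in block m.+1 w ->
  closed_nbhd m x (X :&: block m x) \subset closed_nbhd m.+1 w X.
Proof.
move=> Hx; apply/subsetP=> y; rewrite inE => /andP[Hy H].
rewrite inE -(block_eq Hx) (subsetP (block_sub x (leqnSn m))) //=.
case/orP: H => [/setIP[-> //] | /existsP[z /andP[/setIP[Xz _] adj_zy]]].
by apply/orP; right; apply/existsP; exists z; rewrite Xz.
Qed.

Lemma closed_nbhd_disjoint m x y X Y : m < k -> sym x m != sym y m ->
  [disjoint closed_nbhd m x X & closed_nbhd m y Y].
Proof.
move=> lt_mk /(block_disjoint lt_mk); apply: disjointW.
  by apply/subsetP=> z; rewrite inE => /andP[].
by apply/subsetP=> z; rewrite inE => /andP[].
Qed.

(* If [X] lies in one subblock, its vertices have distinct neighbours outside it. *)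
Lemma card_closed_nbhd_swap m w X x : 0 < m < k -> x \in block m.+1 w ->
    X \subset block m x ->
  #|closed_nbhd m x X| + #|X| <= #|closed_nbhd m.+1 w X|.
Proof.
move=> Hm Hx sXx; have lt_mk : m < k by case/andP: Hm.
have disj : closed_nbhd m x X :&: swap m @: X = set0.
  apply/setP=> y; rewrite in_set0; apply/negP => /setIP[].
  rewrite inE => /andP[/blockP Hy _] /imsetP[z Xz def_y].
  have /blockP Hz := subsetP sXx z Xz.
  have := Hy m; have := Hz m; rewrite def_y sym_swapi // leqnn lt_mk.
  by move=> /(_ isT) <- /(_ isT) /sym_inj; lia.
have sub1 := closed_nbhd_block X Hx; rewrite (setIidPl sXx) in sub1.
rewrite -(card_imset X (inv_inj (swapK lt_mk))) -cardsUI disj.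
rewrite cards0 addn0; apply: subset_leq_card; rewrite subUset sub1 /=.
apply/subsetP=> _ /imsetP[z Xz ->]; rewrite inE -(block_eq Hx).
rewrite swap_block ?(subsetP (block_sub x (leqnSn m))) ?(subsetP sXx) //=.
by apply/orP; right; apply/existsP; exists z; rewrite Xz adj_swap.
Qed.

(** Induction on [m]. If [X] lies in one subblock, its more than [h] vertices each add a neighbour
    outside; otherwise two subblocks meet [X], and each contributes the bound for [h.-1]. *)
Lemma card_closed_nbhd m w X h : 0 < m <= k -> h <= n - k ->
    X \subset block m w -> X != set0 -> mindeg X h ->
  n - k + m + h * (m - 1) <= #|closed_nbhd m w X|.
Proof.
elim: m w X h => // -[_ | m IHm] w X h /andP[_ le_mk] le_h sXw X_n0 degX.
  rewrite muln0 addn0 -(card_block1 w) ?(leq_trans _ le_mk) //.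
  (* The block is a clique, so a single vertex of [X] dominates it. *)
  have /set0Pn[x Xx] := X_n0; have Hx := subsetP sXw x Xx.
  apply/subset_leq_card/subsetP => y Hy; rewrite inE Hy /=.
  have [-> | neq_yx] := eqVneq y x; first by rewrite Xx.
  apply/orP; right; apply/existsP; exists x; rewrite Xx.
  by rewrite adj_block1 // (block_eq Hx).
have Hm : 0 < m.+1 < k by [].
have /set0Pn[x Xx] := X_n0; have Hx := subsetP sXw x Xx.
have [sXx | /subsetPn[y Xy nHy]] := boolP (X \subset block m.+1 x).
  have := card_closed_nbhd_swap Hm Hx sXx.
  have := IHm x X h _ le_h sXx X_n0 degX.
  have := mindeg_card _ Xx degX; nia.
have Hy := subsetP sXw y Xy.
have neq_yx : sym y m.+1 != sym x m.+1.
  by apply: blockS_neq => //; rewrite (block_eq Hx).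
have IH z : z \in X -> n - k + m.+1 + h.-1 * m <=
    #|closed_nbhd m.+1 z (X :&: block m.+1 z)|.
  move=> Xz; have := IHm z (X :&: block m.+1 z) h.-1; rewrite subn1.
  apply; [exact: ltnW | exact: leq_trans (leq_pred h) _ | exact: subsetIr | |
    exact: (mindeg_block Hm sXw degX)].
  by apply/set0Pn; exists z; rewrite inE Xz block_refl.
have sub2 : closed_nbhd m.+1 y (X :&: block m.+1 y) :|:
    closed_nbhd m.+1 x (X :&: block m.+1 x) \subset closed_nbhd m.+2 w X.
  by rewrite subUset !closed_nbhd_block.
have := subset_leq_card sub2.
have disj := closed_nbhd_disjoint (X :&: block m.+1 y) (X :&: block m.+1 x)
  le_mk neq_yx.
rewrite cardsU (disjoint_setI0 disj) cards0 subn0.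
move/(leq_trans (leq_add (IH y Xy) (IH x Xx))); apply: leq_trans.
by apply: pair_bound; rewrite ?subn_gt0.
Qed.

(** * Matching edges between subblocks *)

(** These are the endpoints in subblock [i] of the edges [swap m] leading to subblock [j]. For
    [m = 1] all positions are prescribed; for larger [m], position 1 can still take each of the
    remaining [n - k + m - 1] available symbols. *)
Lemma card_fiber i0 m w (i j : 'I_n) : 0 < m < k ->
    i \in avail m.+1 w -> j \in avail m.+1 w -> i != j ->
  (if m == 1 then 1 else n - k + m - 1) <=
    #|[set p in block m.+1 w | (osym i0 p m == i) && (osym i0 p 0 == j)]|.
Proof.
move=> /andP[m_gt0 lt_mk] Hi Hj neq_ij.
have k_gt0 : 0 < k by apply: leq_trans lt_mk.
have [|q1 [Hq1 q1_m _]] := @relabel_block m.+1 w w m i _ (block_refl _ _) Hi.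
  by rewrite ltnSn.
have [|q2 [Hq2 q2_0 q2E]] := @relabel_block m.+1 w q1 0 j _ Hq1 Hj.
  by rewrite ltnS leq0n.
have q2_m : sym q2 m = i.
  by rewrite q2E ?q1_m // -lt0n.
set F := [set p in _ | _].
case: eqP => [_ | neq_m1].
  apply/card_gt0P; exists q2; rewrite inE Hq2 /=.
  by rewrite -!val_eqE !val_osym // q2_m q2_0 !eqxx.
have sub : avail m.+1 w :\ i :\ j \subset [set osym i0 p 1 | p in F].
  apply/subsetP=> c; rewrite !inE -/(avail _ _) => /and3P[neq_cj neq_ci].
  move=> Hc; have {}Hc : c \in avail m.+1 w by rewrite inE.
  have [|q3 [Hq3 q3_1 q3E]] := @relabel_block m.+1 w q2 1 c _ Hq2 Hc.
    by rewrite ltnS m_gt0.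
  apply/imsetP; exists q3; last first.
    by apply: val_inj; rewrite val_osym ?q3_1 // (leq_ltn_trans m_gt0).
  rewrite inE Hq3 -!val_eqE !val_osym //=.
  rewrite q3E ?q2_m ?val_eqE 1?[i == c]eq_sym //; last exact/eqP.
  by rewrite q3E ?q2_0 ?val_eqE 1?[j == c]eq_sym ?eqxx.
apply: leq_trans (leq_trans (subset_leq_card sub) (leq_imset_card _ _)).
have := card_avail m.+1 w; rewrite (cardsD1 i) Hi (cardsD1 j) in_setD1 Hj.
by rewrite [j == i]eq_sym neq_ij; move: #|_| => a /=; lia.
Qed.

(** Since [swap m] exchanges the symbols at 0 and [m], these are the endpoints, in subblocks
    labelled by [A], of the matching edges into subblocks labelled by [B]. *)
Definition cross i0 m w (A B : {set 'I_n}) : {set kperm n k} :=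
  [set p in block m.+1 w | (osym i0 p m \in A) && (osym i0 p 0 \in B)].

Lemma card_cross i0 m w (A B : {set 'I_n}) : 0 < m < k ->
    A \subset avail m.+1 w -> B \subset avail m.+1 w -> [disjoint A & B] ->
  #|A| * #|B| * (if m == 1 then 1 else n - k + m - 1) <= #|cross i0 m w A B|.
Proof.
move=> Hm /subsetP sA /subsetP sB dAB.
rewrite -[X in _ <= X]sum1_card.
rewrite (partition_big (fun p => (osym i0 p m, osym i0 p 0)) (mem (setX A B))) /=.
  rewrite -cardsX -sum_nat_const; apply: leq_sum => -[i j] /setXP[Ai Bj].
  have neq_ij : i != j by apply: contraTneq Bj => <-; rewrite (disjointFr dAB).
  apply: leq_trans (card_fiber i0 Hm (sA _ Ai) (sB _ Bj) neq_ij) _.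
  rewrite sum1_card; apply/subset_leq_card/subsetP => p.
  rewrite !inE /= => /and3P[Hp /eqP pm /eqP p0].
  by rewrite unfold_in /= !inE Hp pm p0 Ai Bj eqxx.
by move=> p; rewrite !inE => /andP[_ ->].
Qed.

(** * Lower bound for separators inside a block *)

Definition separated X Y : Prop :=
  [disjoint X & Y] /\ forall x y, x \in X -> y \in Y -> ~~ star_adj x y.

Lemma separated_sym X Y : 0 < k -> separated X Y -> separated Y X.
Proof.
move=> k_gt0 [dXY nadj]; split=> [|x y Hx Hy]; first by rewrite disjoint_sym.
by apply: contra (nadj y x Hy Hx); apply: adj_sym.
Qed.

(** The separator contains the closed neighbourhood of [X] minus [X]. The neighbours outside the
    subblock compensate for the removal of [X], leaving at least the size of the closed
    neighbourhood within the subblock. *)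
Lemma card_separator_subblock m w X Y h x : 0 < m < k -> h <= n - k ->
    X \subset block m x -> x \in block m.+1 w -> X != set0 -> mindeg X h ->
    separated X Y ->
  n - k + m + h * (m - 1) <= #|block m.+1 w :\: (X :|: Y)|.
Proof.
move=> Hm le_h sXx Hx X_n0 degX [dXY nadj].
have le1 := card_closed_nbhd_swap Hm Hx sXx.
have le2 : n - k + m + h * (m - 1) <= #|closed_nbhd m x X|.
  by apply: card_closed_nbhd; rewrite // -?andbA; lia.
have sub : closed_nbhd m.+1 w X \subset X :|: (block m.+1 w :\: (X :|: Y)).
  apply/subsetP=> y; rewrite !inE => /andP[-> /orP[-> // |]].
  case/existsP=> z /andP[Xz adj_zy]; rewrite andbT.
  have [//|_ /=] := boolP (y \in X).
  by apply: contraL adj_zy => Yy; apply: nadj.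
have := leq_trans (subset_leq_card sub) (leq_card_setU _ _).
lia.
Qed.

(* Each edge of the matching joining a subblock without [Y] to a subblock
   without [X] has an endpoint in the separator. *)
Lemma card_cross_separator i0 m w X Y (A B : {set 'I_n}) : 0 < m < k ->
    [disjoint A & B] -> separated X Y ->
    (forall p, p \in Y -> osym i0 p m \notin A) ->
    (forall p, p \in X -> osym i0 p m \notin B) ->
  #|cross i0 m w A B| <= #|block m.+1 w :\: (X :|: Y)|.
Proof.
move=> Hm dAB [_ nadj] nYA nXB; have lt_mk : m < k by case/andP: Hm.
(* [f] picks an endpoint in the separator for each matching edge; it is injective because the far
   endpoints have their symbol at [m] in [B], not in [A]. *)
set S := _ :\: _; pose f p := if p \in S then p else swap m p.
have osym_swap p : osym i0 (swap m p) m = osym i0 p 0.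
  by apply: val_inj; rewrite !val_osym ?sym_swapi //; lia.
have swap_n p q : p \in cross i0 m w A B -> q \in cross i0 m w A B -> p != swap m q.
  rewrite !inE => /and3P[_ Ap _] /and3P[_ _ Bq].
  by apply: contraTneq Ap => ->; rewrite osym_swap (disjointFl dAB).
have f_inj : {in cross i0 m w A B &, injective f}.
  move=> p q Hp Hq; rewrite /f; case: ifP => _; case: ifP => _ // eq_f.
  - by case/eqP: (swap_n p q Hp Hq).
  - by case/eqP: (swap_n q p Hq Hp).
  - exact: (inv_inj (swapK lt_mk)).
rewrite -(card_in_imset f_inj); apply/subset_leq_card/subsetP => _ /imsetP[p Hp ->].
rewrite /f; case: ifP => // /negbT pS.
move: Hp; rewrite inE => /and3P[Hp Ap Bp].
move: pS; rewrite in_setD Hp andbT negbK in_setU => pXY.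
have Xp : p \in X by case/orP: pXY => // /nYA; rewrite Ap.
rewrite in_setD in_setU swap_block // andbT negb_or.
have -> /= : swap m p \notin X by apply: contraL Bp => /nXB; rewrite osym_swap.
by apply: contraTN (adj_swap p Hm) => /(nadj _ _ Xp).
Qed.

Lemma block1_not_separated w X Y : 0 < k -> X \subset block 1 w ->
  Y \subset block 1 w -> X != set0 -> Y != set0 -> ~ separated X Y.
Proof.
move=> k_gt0 /subsetP sX /subsetP sY /set0Pn[x Xx] /set0Pn[y Yy] [dXY nadj].
have /negP[] := nadj x y Xx Yy; apply: adj_block1; rewrite ?(block_eq (sX x Xx)) ?sY //.
by apply: contraTneq Yy => ->; rewrite (disjointFr dXY).
Qed.

Lemma separatedI Z X Y : separated X Y -> separated (X :&: Z) (Y :&: Z).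
Proof.
case=> dXY nadj; split=> [|x y /setIP[Xx _] /setIP[Yy _]]; last exact: nadj.
by apply: disjointW dXY; apply: subsetIl.
Qed.

Lemma card_separator m w X Y h : 0 < m <= k -> h <= n - k ->
    X \subset block m w -> Y \subset block m w -> X != set0 -> Y != set0 ->
    mindeg X h -> mindeg Y h -> separated X Y ->
  n - k + m - 1 + h * (m - 2) <= #|block m w :\: (X :|: Y)|.
Proof.
elim: m w X Y h => // -[_ | m IHm] w X Y h /andP[_ le_mk] le_h sX sY X0 Y0 dX dY sep.
  (* For [m = 1] the block is a clique, which cannot be separated. *)
  by case: (block1_not_separated le_mk sX sY X0 Y0 sep).
have Hm : 0 < m.+1 < k by [].
have k_gt0 : 0 < k by apply: leq_ltn_trans le_mk.
have d_gt0 : 0 < n - k by rewrite subn_gt0.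
pose i0 : 'I_n := Ordinal (sym_lt w le_mk).
(* [occ Z] collects the labels of the subblocks that meet [Z]. *)
pose occ (Z : {set kperm n k}) := [set osym i0 p m.+1 | p in Z].
have occ_avail (Z : {set kperm n k}) : Z \subset block m.+2 w -> occ Z \subset avail m.+2 w.
  move/subsetP=> sZ; apply/subsetP=> _ /imsetP[p Zp ->].
  by apply: (avail_sym (sZ p Zp) (ltnSn _)); rewrite ?val_osym.
have osym_block p q : p \in block m.+2 w -> q \in block m.+2 w ->
    osym i0 p m.+1 = osym i0 q m.+1 -> p \in block m.+1 q.
  move=> Hp Hq /(congr1 val); rewrite !val_osym // => eq_m.
  by apply: blockS; rewrite // (block_eq Hq).
have sub_occ (Z : {set kperm n k}) : Z \subset block m.+2 w -> Z != set0 -> #|occ Z| <= 1 ->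
    exists2 x, x \in block m.+2 w & Z \subset block m.+1 x.
  move=> /subsetP sZ /set0Pn[x Zx] le1; exists x; first exact: sZ.
  apply/subsetP=> p Zp; apply: osym_block; rewrite ?sZ //.
  by apply: (card_le1_eqP le1); apply: imset_f.
(* For [m = 0] the subblocks are cliques, so none meets both sides. *)
have occ0 : m = 0 -> #|occ X :&: occ Y| = 0.
  move=> m0; apply/eqP; rewrite cards_eq0; apply: contraT => /set0Pn[i /setIP[]].
  case/imsetP=> x Xx -> /imsetP[y Yy eq_xy].
  have Hx := subsetP sX x Xx; have Hy := subsetP sY y Yy.
  case: (@block1_not_separated x (X :&: block m.+1 x) (Y :&: block m.+1 x)) => //.
  - by rewrite m0 subsetIr.
  - by rewrite m0 subsetIr.
  - by apply/set0Pn; exists x; rewrite in_setI Xx block_refl.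
  - by apply/set0Pn; exists y; rewrite in_setI Yy osym_block.
  - exact: separatedI.
have [gt1 | le1] :=
    ltnP 1 #|occ X :&: occ Y|.
  have m_n0 : m != 0 by apply: contraTneq gt1 => /occ0 ->.
  case/card_gt1P: gt1 => i [j [/setIP[Xi Yi] /setIP[Xj Yj] neq_ij]].
  have IH z : z \in X -> osym i0 z m.+1 \in occ Y ->
      n - k + m.+1 - 1 + h.-1 * (m.+1 - 2) <=
      #|block m.+1 z :\: (X :|: Y)|.
    move=> Xz /imsetP[y Yy eq_zy].
    have Hz := subsetP sX z Xz; have Hy := subsetP sY y Yy.
    have -> : block m.+1 z :\: (X :|: Y) =
        block m.+1 z :\: (X :&: block m.+1 z :|: Y :&: block m.+1 z).
      by apply/setP=> p; rewrite -setIUl !in_setD in_setI; case: (p \in block _ _);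
         rewrite ?andbT ?andbF.
    apply: IHm; rewrite ?subsetIr ?(ltnW le_mk) ?(leq_trans (leq_pred h)) //.
    - by apply/set0Pn; exists z; rewrite in_setI Xz block_refl.
    - by apply/set0Pn; exists y; rewrite in_setI Yy osym_block.
    - exact: (mindeg_block Hm sX dX).
    - exact: (mindeg_block Hm sY dY).
    - exact: separatedI.
  case/imsetP: Xi Yi neq_ij => x Xx ->; case/imsetP: Xj Yj => y Xy -> Yj Yi neq_xy.
  have Hx := subsetP sX x Xx; have Hy := subsetP sX y Xy.
  have dxy : [disjoint block m.+1 x & block m.+1 y].
    apply: block_disjoint => //; apply: contra neq_xy => /eqP eq_m.
    by apply/eqP/val_inj; rewrite !val_osym.
  have le2 : #|block m.+1 x :\: (X :|: Y)| + #|block m.+1 y :\: (X :|: Y)| <=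
      #|block m.+2 w :\: (X :|: Y)|.
    rewrite -cardsUI -setDUl -setDIl (disjoint_setI0 dxy) set0D cards0 addn0.
    apply/subset_leq_card/setSD; rewrite subUset.
    by rewrite -{1}(block_eq Hx) -(block_eq Hy) !block_sub.
  exact: (split_bound d_gt0 le_h m_n0 le2 (IH x Xx Yi) (IH y Xy Yj)).
(* [A] labels the subblocks missing [Y], [B] those meeting [Y] but not [X]; at most one further
   subblock meets both. *)
pose A := avail m.+2 w :\: occ Y; pose B := occ Y :\: occ X.
have dAB : [disjoint A & B].
  by rewrite -setI_eq0; apply/eqP/setP=> i; rewrite !inE; case: (i \in occ Y);
     rewrite ?andbF.
have cardAB : #|A| + #|B| + #|occ X :&: occ Y| = n - k + m.+2.
  rewrite -addnA [#|B| + _]addnC setIC cardsID addnC.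
  have := cardsID (occ Y) (avail m.+2 w).
  by rewrite (setIidPr (occ_avail Y sY)) card_avail => ->; lia.
have boundE : n - k + m.+2 - 1 + h * (m.+2 - 2) = n - k + m.+1 + h * (m.+1 - 1).
  by rewrite !subSS addnS subn1.
(* If [A] is empty, every subblock meeting [X] also meets [Y], so [X] occupies just one. An empty
   [B] gives the same with the sides exchanged. *)
have [A0 | A_n0] := eqVneq A set0.
  have sXY : occ X \subset occ Y.
    by apply: subset_trans (occ_avail X sX) _; rewrite -setD_eq0 -/A A0.
  rewrite (setIidPl sXY) in le1.
  have [x Hx sXx] := sub_occ X sX X0 le1.
  by rewrite boundE; apply: card_separator_subblock Hm le_h sXx Hx X0 dX sep.
have [B0 | B_n0] := eqVneq B set0.
  have sYX : occ Y \subset occ X by rewrite -setD_eq0 -/B B0.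
  rewrite (setIidPr sYX) in le1.
  have [y Hy sYy] := sub_occ Y sY Y0 le1.
  rewrite boundE setUC.
  exact: card_separator_subblock Hm le_h sYy Hy Y0 dY (separated_sym k_gt0 sep).
have [sA sB] : A \subset avail m.+2 w /\ B \subset avail m.+2 w.
  by split; [apply: subsetDl | apply: subset_trans (subsetDl _ _) (occ_avail Y sY)].
have le_AB := card_cross i0 Hm sA sB dAB.
have le_T : #|cross i0 m.+1 w A B| <= #|block m.+2 w :\: (X :|: Y)|.
  apply: card_cross_separator => // p Zp; rewrite in_setD.
    by rewrite (imset_f (fun p => osym i0 p m.+1) Zp).
  by rewrite (imset_f (fun p => osym i0 p m.+1) Zp).
apply: leq_trans le_T; apply: leq_trans le_AB.
rewrite -card_gt0 in A_n0; rewrite -card_gt0 in B_n0.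
(* For [m = 0] each pair of labels gives one edge, and [a + b = n - k + 2] with [a], [b] positive
   already forces [a * b >= n - k + 1]. *)
case: ifP => [/eqP[m0] | neq_m].
  by move: cardAB A_n0 B_n0; rewrite (occ0 m0) m0; move: #|A| #|B| => a b; nia.
by apply: (cross_bound d_gt0 le_h _ A_n0 B_n0 le1 cardAB); rewrite -eqSS neq_m.
Qed.

(** * From h-cuts to separators of the whole graph *)

Lemma connect_closed (e : rel (kperm n k)) (P : pred (kperm n k)) x y :
  (forall u v, P u -> e u v -> P v) -> P x -> connect e x y -> P y.
Proof.
move=> closedP Px /connectP[s]; elim: s x Px => [x Px _ -> // | z s IHs x Px /=].
by case/andP=> /(closedP x z Px); apply: IHs.
Qed.

Lemma card_h_cut_ge h (S : {set kperm n k}) : 0 < k -> h <= n - k ->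
  h_cut (@star_adj n k) h S -> n - 1 + h * (k - 2) <= #|S|.
Proof.
move=> k_gt0 le_h [[x [y [xS yS nconn]]] degS].
(* [X] is the component of [x] and [Y] the union of all other components, so both inherit the
   minimum degree of the remaining graph. *)
pose X := [set z | connect (del_rel (@star_adj n k) S) x z].
pose Y := ~: (S :|: X).
have notS z : z \in X -> z \notin S.
  rewrite inE; apply: (@connect_closed _ (fun v => v \notin S)) => // u v _.
  by case/and3P.
have stepX u v : u \in X -> v \notin S -> star_adj u v -> v \in X.
  move=> Xu vS adj_uv; rewrite inE; move: (Xu); rewrite inE => /connect_trans; apply.
  by apply: connect1; rewrite /del_rel notS // vS.
have -> : n - 1 = n - k + k - 1 by lia.
apply: (@leq_trans #|block k x :\: (X :|: Y)|); last first.
  apply/subset_leq_card/subsetP=> z; rewrite in_setD in_setU in_setC in_setU.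
  by case/andP; case: (z \in X); case: (z \in S).
apply: card_separator; rewrite ?k_gt0 ?leqnn //.
- by apply/subsetP=> z _; apply: block_full.
- by apply/subsetP=> z _; apply: block_full.
- by apply/set0Pn; exists x; rewrite inE connect0.
- by apply/set0Pn; exists y; rewrite in_setC in_setU negb_or yS inE.
- move=> u Xu; apply: leq_trans (degS u (notS u Xu)) _.
  apply/subset_leq_card/subsetP=> v; rewrite [in X in X -> _]inE => /and3P[_ vS adj_uv].
  by rewrite inE adj_uv (stepX u).
- move=> u; rewrite in_setC in_setU negb_or => /andP[uS uX].
  apply: leq_trans (degS u uS) _; apply/subset_leq_card/subsetP=> v.
  rewrite inE => /and3P[_ vS adj_uv]; rewrite inE adj_uv andbT in_setC in_setU negb_or vS.
  by apply: contra uX => /stepX; apply => //; apply: adj_sym.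
split; first by rewrite disjoints_subset setCK subsetUr.
move=> u v Xu; rewrite in_setC in_setU negb_or => /andP[vS].
by apply: contra; apply: stepX.
Qed.

(** * The cut around part of a clique *)

Lemma swap_notin_block1 w x i :
  0 < i < k -> x \in block 1 w -> swap i x \notin block 1 w.
Proof.
move=> /andP[i_gt0 lt_ik] /blockP Hx; apply/negP => /blockP/(_ i).
by rewrite sym_swapi // i_gt0 lt_ik -Hx ?i_gt0 // => /(_ isT)/sym_inj; lia.
Qed.

(** Distinct outside neighbours of a clique lie in distinct cliques: [swap i x] has the first symbol
    of [x] at position [i], whereas [swap j y] with [j != i] still has the symbol of [w] there. *)
Lemma swap_block1_inj w x y i j : 0 < i < k -> 0 < j < k ->
    x \in block 1 w -> y \in block 1 w -> swap j y \in block 1 (swap i x) ->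
  i = j /\ x = y.
Proof.
move=> Hi Hj /blockP Hx /blockP Hy /blockP Hs.
have lt_ik : i < k by case/andP: Hi.
have := Hs i Hi; rewrite sym_swapi //.
have [<- | neq_ij] := eqVneq i j.
  rewrite sym_swapi // => eq0; split=> //; apply: kperm_ext => -[|a] Ha //.
  by rewrite Hx ?Hy.
by rewrite sym_swap_neq //; [rewrite Hy // -Hx // => /sym_inj; lia | lia].
Qed.

(** For nonempty [X] inside [block 1 w], this is the open neighbourhood of [X]: the rest of the
    clique and all outside neighbours. *)
Definition nbhd_cut w X : {set kperm n k} :=
  (block 1 w :\: X) :|:
  [set swap (val z.1) z.2 | z in setX [set i : 'I_k | 0 < i] X].

Section CliqueCut.
Variables (w : kperm n k) (X : {set kperm n k}).
Hypotheses (k_gt1 : 1 < k) (sXw : X \subset block 1 w).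
Let k_gt0 : 0 < k. Proof. exact: ltnW. Qed.

Lemma nbhd_cutP p : reflect ((p \in block 1 w /\ p \notin X) \/
    exists i x, [/\ 0 < i < k, x \in X & p = swap i x]) (p \in nbhd_cut w X).
Proof.
rewrite in_setU in_setD; apply: (iffP orP) => -[].
- by case/andP; left.
- case/imsetP=> -[i x] /setXP[]; rewrite inE /= => i_gt0 Xx ->; right.
  by exists i, x; rewrite i_gt0 /=.
- by case=> -> ->; left.
- case=> i [x [/andP[i_gt0 lt_ik] Xx ->]]; right; apply/imsetP.
  by exists (Ordinal lt_ik, x); rewrite // in_setX inE /= i_gt0.
Qed.

Lemma card_nbhd_cut : #|nbhd_cut w X| = n - k + 1 - #|X| + (k - 1) * #|X|.
Proof.
rewrite /nbhd_cut cardsU; set Sw := [set _ | _ in _].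
have -> : (block 1 w :\: X) :&: Sw = set0.
  apply/setP=> p; rewrite in_set0; apply/negP => /setIP[/setDP[Hp _]].
  case/imsetP=> -[i x] /setXP[]; rewrite inE /= => i_gt0 Xx def_p.
  have := @swap_notin_block1 w x i; rewrite i_gt0 ltn_ord -def_p Hp.
  by move=> /(_ isT (subsetP sXw x Xx)).
rewrite cards0 subn0 cardsD (setIidPr sXw) card_block1 //; congr (_ + _).
rewrite card_in_imset ?cardsX.
  congr (_ * _); rewrite subn1 -[in RHS](card_ord k) -(cardsC1 (Ordinal k_gt0)).
  by apply: eq_card => i; rewrite !inE lt0n -val_eqE.
move=> [i x] [j y] /setXP[]; rewrite inE /= => i_gt0 Xx /setXP[].
rewrite inE /= => j_gt0 Xy eq_s.
have [||||| /val_inj -> -> //] := @swap_block1_inj w x y i j.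
- by rewrite i_gt0 /=.
- by rewrite j_gt0 /=.
- exact: (subsetP sXw).
- exact: (subsetP sXw).
- by rewrite eq_s block_refl.
Qed.

Lemma nbhd_cut_disjoint x : x \in X -> x \notin nbhd_cut w X.
Proof.
move=> Xx; apply/negP => /nbhd_cutP[[_] | [i [y [Hi Xy def_x]]]]; first by rewrite Xx.
have := swap_notin_block1 Hi (subsetP sXw y Xy).
by rewrite -def_x (subsetP sXw).
Qed.

Lemma nbhd_cut_disconnected :
  X != set0 -> disconnected_minus (@star_adj n k) (nbhd_cut w X).
Proof.
case/set0Pn=> x Xx; have Hx := subsetP sXw x Xx.
have H1 : 0 < 1 < k by [].
(* The other side of the cut is witnessed by a second vertex of the clique of [swap 1 x]; that
   clique has at least two vertices and only [swap 1 x] is deleted from it. *)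
have [y] : exists y, y \in block 1 (swap 1 x) :\ swap 1 x.
  apply/set0Pn; rewrite -card_gt0; have := cardsD1 (swap 1 x) (block 1 (swap 1 x)).
  by rewrite card_block1 // block_refl; move: #|_| => c; lia.
rewrite in_setD1 => /andP[neq_y Hy].
have Hyw : y \notin block 1 w.
  apply: contra (swap_notin_block1 H1 Hx) => /block_eq <-.
  by rewrite (block_eq Hy) block_refl.
exists x, y; split; first exact: nbhd_cut_disjoint.
  apply/nbhd_cutP=> -[[Hw _] | [i [x' [Hi Xx' def_y]]]]; first by rewrite Hw in Hyw.
  have := @swap_block1_inj w x x' 1 i H1 Hi Hx (subsetP sXw x' Xx').
  by rewrite -def_y => /(_ Hy)[eq_i eq_x]; rewrite def_y -eq_i -eq_x eqxx in neq_y.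
apply: contra Hyw => conn; apply: (subsetP sXw).
apply: (@connect_closed _ (fun v => v \in X)) conn => // u v Xu.
case/and3P=> _ vS /(adjP _ _ k_gt0) adj_uv.
apply: contraR vS => vX; apply/nbhd_cutP.
case: adj_uv => [[i Hi ->] | [_ Hv]]; first by right; exists i, u.
by left; rewrite -(block_eq (subsetP sXw u Xu)).
Qed.

(** A vertex of [X] keeps the rest of [X]. Any other remaining vertex has [n - k] neighbours in its
    clique and loses at most one of them, for which a surviving swap then compensates. *)
Lemma nbhd_cut_mindeg h : h < #|X| <= n - k + 1 ->
  mindeg_minus_ge (@star_adj n k) (nbhd_cut w X) h.
Proof.
case/andP=> lt_hX le_X u uS; have le_h : h <= n - k by lia.
have nbr v : v \in block 1 u -> v != u -> v \notin nbhd_cut w X ->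
    v \in [set v | del_rel (@star_adj n k) (nbhd_cut w X) u v].
  by move=> Hv neq_v vS; rewrite inE /del_rel uS vS adj_block1.
have [Xu | uX] := boolP (u \in X).
  have lt_h : h <= #|X :\ u| by move: lt_hX; rewrite (cardsD1 u) Xu.
  apply: leq_trans lt_h _; apply/subset_leq_card/subsetP=> v.
  rewrite in_setD1 => /andP[neq_v Xv]; apply: nbr; rewrite ?nbhd_cut_disjoint //.
  by rewrite (block_eq (subsetP sXw u Xu)) (subsetP sXw).
have uw : u \notin block 1 w.
  by apply: contra uS => Hu; apply/nbhd_cutP; left.
have notw v : v \in block 1 u -> v \notin block 1 w.
  by move=> Hv; apply: contra uw => /block_eq <-; rewrite (block_eq Hv) block_refl.
have card_u : #|block 1 u :\ u| = n - k.
  have := cardsD1 u (block 1 u).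
  by rewrite card_block1 // block_refl; move: #|_| => c; lia.
have [/exists_inP[z Hz /nbhd_cutP[[Hzw _] | [i [x [Hi Xx def_z]]]]] | no_z] :=
    boolP [exists z in block 1 u, z \in nbhd_cut w X].
- by have := notw z Hz; rewrite Hzw.
- have lt_ik : i < k by case/andP: Hi.
  have Hx := subsetP sXw x Xx.
  have uz : u \in block 1 z by rewrite (block_eq Hz) block_refl.
  have neq_zu : z != u.
    by apply: contraNneq uS => <-; apply/nbhd_cutP; right; exists i, x.
  have su_notu : swap i u \notin block 1 u := swap_notin_block1 Hi (block_refl 1 u).
  (* The deleted [z = swap i x] is replaced by [swap i u]. Were that deleted too, comparing symbols
     would give [u = z], put [u] in [X], or repeat a symbol in a vertex of [X]. *)
  have sub : swap i u |: (block 1 u :\ u :\ z) \subset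
      [set v | del_rel (@star_adj n k) (nbhd_cut w X) u v].
    rewrite subUset sub1set; apply/andP; split.
      rewrite inE /del_rel uS adj_swap // andbT /=.
      apply/nbhd_cutP=> -[[/blockP/(_ i Hi)] | [j [y [Hj Xy def_s]]]].
        rewrite sym_swapi // -(blockP _ _ _ Hx i Hi) => eq_0.
        case/eqP: neq_zu; apply: kperm_ext => -[|a] lt_ak.
          by rewrite def_z sym_swap0.
        by have /blockP Hz' := Hz; apply: Hz'.
      have Hy := subsetP sXw y Xy.
      have [eq_ij | neq_ij] := eqVneq i j.
        case/negP: uX; rewrite -eq_ij in def_s.
        by rewrite (inv_inj (swapK lt_ik) def_s).
      have := congr1 (fun p => sym p j) def_s.
      have /andP[j_gt0 lt_jk] := Hj.
      rewrite sym_swapi // sym_swap_neq //; last by rewrite eq_sym.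
      rewrite (blockP _ _ _ uz j Hj) def_z sym_swap_neq //; last by rewrite eq_sym.
      rewrite (blockP _ _ _ Hx j Hj) -(blockP _ _ _ Hy j Hj).
      by move/(sym_inj lt_jk k_gt0)=> j0; rewrite j0 in j_gt0.
    apply/subsetP=> v; rewrite !in_setD1 => /and3P[neq_vz neq_vu Hv].
    apply: nbr => //; apply/nbhd_cutP=> -[[Hvw _] | [j [y [Hj Xy def_v]]]].
      by have := notw v Hv; rewrite Hvw.
    have := @swap_block1_inj w x y i j Hi Hj Hx (subsetP sXw y Xy).
    rewrite -def_v -def_z (block_eq Hz) => /(_ Hv)[eq_i eq_x].
    by rewrite def_v def_z eq_i eq_x eqxx in neq_vz.
  apply: leq_trans (subset_leq_card sub).
  rewrite cardsU1 !in_setD1 (negbTE su_notu) !andbF /=.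
  by move: card_u; rewrite (cardsD1 z) in_setD1 neq_zu Hz /= => ->.
apply: (@leq_trans #|block 1 u :\ u|); first by rewrite card_u.
apply/subset_leq_card/subsetP=> v; rewrite in_setD1 => /andP[neq_v Hv].
by apply: nbr => //; apply: contra no_z => vS; apply/exists_inP; exists v.
Qed.

End CliqueCut.

End StarGraph.

Theorem theorem3p4 (n k h : nat) (hk : 2 <= k) (hkn : k <= n - 1) (hh : h <= n - k) :
  h_super_conn_eq (@star_adj n k) h (n + h * (k - 2) - 1).
Proof.
have lt_kn : k < n by lia.
have k_gt0 : 0 < k by lia.
split=> [|S cutS]; last first.
  by rewrite -addnBAC ?(card_h_cut_ge lt_kn k_gt0 hh cutS) // (leq_trans k_gt0 (ltnW lt_kn)).
(* Any vertex serves as [w]; the identity arrangement shows that one exists. *)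
have [||w _] := @kperm_exists n k id; [by move=> j; lia | by [] |].
have [|s [s_uniq s_size sub_s]] := @card_geqP _ (mem (block 1 w)) h.+1 _.
  by rewrite card_block1 //; lia.
have cardX : #|[set x in s]| = h.+1 by rewrite cardsE (card_uniqP s_uniq).
have sX : [set x in s] \subset block 1 w.
  by apply/subsetP=> x; rewrite inE; apply: sub_s.
exists (nbhd_cut w [set x in s]); split; last first.
  (* The count is [(n - k - h) + (k - 1) * (h + 1)]. *)
  rewrite card_nbhd_cut // cardX; nia.
split; first by apply: nbhd_cut_disconnected; rewrite // -card_gt0 cardX.
by apply: nbhd_cut_mindeg; rewrite // cardX; lia.
Qed.
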